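(* For real $r$ define $U_r = \frac12 r(r+1)$, so that $U_r = \sum_{q=1}^{r} q$ when $r \in \mathbb{N}$. For positive integers $n$ and $k$ define the average $$\bar U_{n/k} = \frac{1}{k}\sum_{j=0}^{k-1} U_{\frac{n-j}{k}}.$$ Then for all positive integers $n, k$ with $2 \le k < n$ one has the exact identity $$\frac{U_n - k^2\,\bar U_{n/k}}{1-k^2} = -\frac{1}{12},$$ that is, $U_n - k^2\bar U_{n/k} = -\frac{1}{12}(1-k^2)$. *)

(* Defs.v *)
From mathcomp Require Import all_boot all_order all_algebra.
From mathcomp Require Import reals ring.
Set Implicit Arguments.
Unset Strict Implicit.
Unset Printing Implicit Defensive.
Import Order.TTheory GRing.Theory Num.Theory.
Local Open Scope ring_scope.

Definition U (R : realType) (r : R) : R := 2^-1 * r * (r + 1).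

Lemma U_nat (R : realType) (r : nat) :
  U (r%:R : R) = \sum_(1 <= q < r.+1) q%:R.
Proof.
elim: r => [|r IHr]; first by rewrite big_geq // /U mulr0 mul0r.
rewrite big_nat_recr //= -IHr /U -[r.+1%:R]natr1.
by field.
Qed.

Definition Ubar (R : realType) (n k : nat) : R :=
  k%:R^-1 * \sum_(0 <= j < k) U ((n%:R - j%:R) / k%:R).

(* Main.v *)
Require Import Defs.
From mathcomp Require Import all_boot all_order all_algebra.
From mathcomp Require Import reals.
From mathcomp Require Import ring.
Set Implicit Arguments.
Unset Strict Implicit.
Unset Printing Implicit Defensive.
Import Order.TTheory GRing.Theory Num.Theory.
Local Open Scope ring_scope.

(** Since [U] is quadratic, the sum over [j] reduces to the sums of [j] and [j ^+ 2]. At [m] = [d] =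
    [k], [x] = [n], the terms in n k cancel and k^2 times the average is U_n + (1 - k^2)/12: only a
    constant independent of n is left over. *)

(* The number [m] of terms is kept apart from the divisor [d] so that the
   closed form can be proved by induction on [m]. *)
Lemma sum_U_shift (R : realType) (x d : R) (m : nat) : d != 0 ->
  \sum_(0 <= j < m) U ((x - j%:R) / d) =
  (m%:R * x ^+ 2 - x * m%:R * (m%:R - 1)
   + m%:R * (m%:R - 1) * (2 * m%:R - 1) / 6
   + d * (m%:R * x - m%:R * (m%:R - 1) / 2)) / (2 * d ^+ 2).
Proof.
move=> d0; elim: m => [|m IHm]; first by rewrite big_geq //; field.
by rewrite big_nat_recr //= IHm /U -[m.+1%:R]natr1; field.
Qed.

Theorem theorem2 (R : realType) (n k : nat) (hk : (2 <= k)%N) (hkn : (k < n)%N) :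
  (U (n%:R : R) - k%:R ^+ 2 * Ubar R n k) / (1 - k%:R ^+ 2) = - (1 / 12)
  /\ U (n%:R : R) - k%:R ^+ 2 * Ubar R n k = - (1 / 12) * (1 - k%:R ^+ 2).
Proof.
have k0 : (k%:R : R) != 0 by rewrite pnatr_eq0 -lt0n (ltn_trans _ hk).
have k1 : 1 - (k%:R : R) ^+ 2 != 0.
  (* Read in [nat], k^2 = 1^2 would force k = 1, against [hk]. *)
  by rewrite subr_eq0 eq_sym -natrX pnatr_eq1 -[1%N](exp1n 2) eqn_sqr gtn_eqF.
have E : U (n%:R : R) - k%:R ^+ 2 * Ubar R n k = - (1 / 12) * (1 - k%:R ^+ 2).
  by rewrite /Ubar sum_U_shift // /U; field.
by split; rewrite // E mulfK.
Qed.
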